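(* Let $q\in(0,\tfrac12)$, let $k_1\geq k_2\geq\dots\geq k_m$ be positive integers, and put $K=\sum_{i=1}^m k_i$. Assume that there exist positive integers $n_0$ and $n$ such that each of the numbers $n_0,n_0+1,\dots,n_0+n$ can be obtained by summing up the numbers $k_1,\dots,k_m$, i.e. for every $j\in\{0,1,\dots,n\}$ there are $\varepsilon_1,\dots,\varepsilon_m\in\{0,1\}$ with $n_0+j=\sum_{i=1}^m\varepsilon_i k_i$. Then: (1) if $q\geq\frac{1}{n+1}$, then $E(k_1,\dots,k_m;q)$ has nonempty interior; (2) if $q<\frac{k_m}{K+k_m}$, then $E(k_1,\dots,k_m;q)$ is not a finite union of intervals; (3) consequently, if $\frac{1}{n+1}\leq q<\frac{k_m}{K+k_m}$, then $E(k_1,\dots,k_m;q)$ is a Cantorval.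
   Context: For an absolutely summable real sequence $x=(x(1),x(2),\dots)$ with infinitely many nonzero terms, its achievement set is $E(x)=\{\sum_{n=1}^\infty \varepsilon_n x(n):\varepsilon_n\in\{0,1\}\}$, the set of all subsums of $\sum_{n=1}^\infty x(n)$. For $q\in(0,\frac12)$, $(k_1,k_2,\dots,k_m;q)$ denotes the (multigeometric) sequence $(k_1,\dots,k_m,k_1q,\dots,k_mq,k_1q^2,\dots,k_mq^2,\dots)$, and $E(k_1,\dots,k_m;q)$ is its achievement set. A Cantorval (more precisely, an $\mathcal{M}$-Cantorval) is a nonempty compact subset $S$ of the real line such that $S$ is the closure of its interior, and both endpoints of any connected component of $S$ with nonempty interior are accumulation points of one-point components of $S$. *)

(* Defs.v *)
From HB Require Import structures.
From mathcomp Require Import all_boot all_order all_algebra.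
From mathcomp Require Import all_classical all_reals all_analysis.

Set Implicit Arguments.
Unset Strict Implicit.
Unset Printing Implicit Defensive.

Import Order.TTheory GRing.Theory Num.Theory.
Import numFieldNormedType.Exports.

Local Open Scope classical_set_scope.
Local Open Scope ring_scope.

(* Sequences are indexed from 0: x n is the (n+1)-st term. *)
Definition achievement_set (R : realType) (x : R^nat) : set R :=
  [set s | exists eps : nat -> bool,
     series (fun n => (eps n)%:R * x n) @ \oo --> s].

Definition multigeometric (R : realType) (k : seq nat) (q : R) : R^nat :=
  fun n => (nth 0%N k (n %% size k))%:R * q ^+ (n %/ size k).

(* Intervals may be open, closed, half-open, unbounded, degenerate or empty. *)
Definition finite_union_of_intervals (R : realType) (A : set R) : Prop :=
  exists s : seq (interval R), A = \big[setU/set0]_(I <- s) [set` I].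

Definition one_point_components (T : topologicalType) (A : set T) : set T :=
  [set x | A x /\ connected_component A x = [set x]].

(* A component of a compact set of reals is a compact interval, so its
   endpoints are its infimum and its supremum. *)
Definition cantorval (R : realType) (S : set R) : Prop :=
  [/\ S !=set0, compact S, S = closure (interior S) &
      forall x, S x ->
        let C := connected_component S x in
        interior C !=set0 ->
        limit_point (one_point_components S) (inf C) /\
        limit_point (one_point_components S) (sup C)].

(* Main.v *)
Require Import Defs.
From HB Require Import structures.
From mathcomp Require Import all_boot all_order all_algebra.
From mathcomp Require Import all_classical all_reals all_analysis.
From mathcomp Require Import lra.

(** The achievement set E of a multigeometric sequence is self-similar: cutting
a subsum after its first m terms gives E = D + q E, where D is the finite set
of subset sums of k.  Moreover E contains every bounded set A with
A included in D + q A ([achievement_maximal]), since expanding a point of A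
again and again produces an itinerary of digits whose partial sums converge to
that point ([cvg_itinerary]).  Write L = K / (1 - q) for the sum of the whole
sequence; E lies in [0, L], contains L, and s |-> L - s maps E to itself, by
complementing the set of chosen terms.

(1) Put A = [a, a + l] with a = n0 / (1 - q) and l = n / (1 - q).  The n + 1
sets n0 + j + q A are intervals of length q l, whose left endpoints are
consecutive translates by 1; when q (n + 1) >= 1 we have q l >= 1, so they
cover A, and A is included in E by maximality.

(2) The bound on q says q L < km.  As a nonzero digit is at least km, points of
E below km lie in q E, hence in [0, q L]: the interval ]q L, km[ is a gap of E,
and so are its images under multiplication by q ^+ N.  These gaps accumulate
at 0, as do the points q ^+ N * L of E, which no finite union of intervals
permits ([finite_union_germ]).

(3) Closedness of E follows from maximality applied to its closure, and density
of the interior from self-similarity, because a small copy of E, with its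
interior points, sits near each point of E.  It remains to see that one-point
components accumulate at the ends of a nontrivial component C.  The key fact
([self_similar_gaps]) is that a point u of E at which a gap starts is also a
limit of gaps from the left: at a scale finer than that gap, u must be the
right end of its piece t + q ^+ N * E, no other piece reaches the vicinity of u
from the left, and gaps accumulate at the right end L of E by (2) and symmetry.
Thus {u} is a component, and no gap starts at b = sup C.  Hence E has points
just after b, but no interval of E continues C, so that there are gaps
arbitrarily close to b on its right; each of them starts at a one-point
component other than b ([sup_component_limit]).  Symmetry gives the other
end. *)

Import Order.TTheory GRing.Theory Num.Theory.
Import numFieldNormedType.Exports.
Local Open Scope classical_set_scope.
Local Open Scope ring_scope.

Set Implicit Arguments.
Unset Strict Implicit.
Unset Printing Implicit Defensive.

(** * Components of closed sets of reals *)

Lemma closure_distP (R : realType) (A : set R) (x : R) :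
  closure A x <-> forall e, 0 < e -> exists2 y, A y & `|x - y| < e.
Proof.
split=> [Ax e e0|H B /nbhs_ballP[e /= e0 eB]].
  by have [y [Ay xy]] := Ax _ (nbhsx_ballx x e e0); exists y.
by have [y Ay xy] := H _ e0; exists y; split=> //; exact: eB.
Qed.

Lemma interior_distP (R : realType) (A : set R) (x : R) :
  interior A x <-> exists2 e, 0 < e & forall y, `|x - y| < e -> A y.
Proof.
split=> [/nbhs_ballP[e /= e0 eA]|[e e0 eA]].
  by exists e => // y xy; exact: eA.
by apply/nbhs_ballP; exists e => // y xy; exact: eA.
Qed.

Lemma component_itv (R : realType) (S : set R) (x y z t : R) :
  connected_component S x y -> connected_component S x z ->
  y <= t <= z -> connected_component S x t.
Proof.
move=> xy xz; apply: (connected_intervalP _).1 xy xz t.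
exact: component_connected.
Qed.

Lemma component_segment (R : realType) (S : set R) (x y z : R) :
  connected_component S x y -> y <= z ->
  (forall t, y <= t <= z -> S t) -> connected_component S x z.
Proof.
move=> xy yz yzS; rewrite (same_connected_component xy).
apply: (@connected_component_max _ S `[y, z]%classic y).
- by rewrite /= in_itv/= lexx.
- by move=> t /=; rewrite in_itv/=; exact: yzS.
- exact: segment_connected.
- by rewrite /= in_itv/= lexx yz.
Qed.

Definition gap_after (R : realType) (S : set R) (u : R) : Prop :=
  exists2 g, 0 < g & forall t, u < t -> t < u + g -> ~ S t.

Definition left_limit_of_gaps (R : realType) (S : set R) (u : R) : Prop :=
  forall e, 0 < e -> exists2 t, u - e < t < u & ~ S t.

Definition gaps_before_gaps (R : realType) (S : set R) : Prop :=
  forall u, S u -> gap_after S u -> left_limit_of_gaps S u.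

(** This is how one-point components are found: the gap after u stops its
component on the right, the gaps accumulating before u stop it on the left. *)
Lemma gap_one_point (R : realType) (S : set R) (u : R) :
  gaps_before_gaps S -> S u -> gap_after S u -> one_point_components S u.
Proof.
move=> HS Su Gu; split=> //; apply/seteqP; split=> [y uy|_ ->]; last first.
  exact: connected_component_refl.
have [g g0 gS] := Gu; have uu := connected_component_refl Su.
have sub t : connected_component S u t -> S t.
  exact: connected_component_sub.
case: (ltgtP y u) => // yu.
  have /HS -/(_ Gu (u - y)) := Su; rewrite subr_gt0 => /(_ yu)[t] /andP[yt tu].
  by case; apply/sub/(component_itv uy uu); lra.
have : ~ S (Num.min y (u + g / 2)).
  by apply: gS; rewrite ?lt_min ?gt_min; lra.
case; apply/sub/(component_itv uu uy).
by rewrite le_min ge_min lexx; lra.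
Qed.

(** No gap starts at the supremum b of a nontrivial component, since gaps would
then accumulate at b from inside the component.  So every right neighbourhood
of b meets S and, the component being maximal, misses a point of S too; the
last point of S before a missing point is a one-point component. *)
Lemma sup_component_limit (R : realType) (S : set R) (x : R) :
  compact S -> gaps_before_gaps S -> S x ->
  let C := connected_component S x in
  interior C !=set0 -> limit_point (one_point_components S) (sup C).
Proof.
move=> cS HS Sx C [c /interior_distP[e e0 ceC]]; set b := sup C.
have clS : closed S by apply: compact_closed.
have CS : C `<=` S by exact: connected_component_sub.
have Cc : C c by apply: ceC; rewrite subrr normr0.
have ubC : has_sup C.
  split; first by exists c.
  have /compact_bounded[M [_ /(_ (M + 1))]] := cS.
  rewrite ltrDl ltr01 => /(_ isT) MS; exists (M + 1) => t /CS /MS /=.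
  exact/le_trans/ler_norm.
have leb t : C t -> t <= b by move=> Ct; apply: ub_le_sup => //; case: ubC.
have Cb : C b.
  rewrite (closure_id C).1; last exact: component_closed.
  by apply: closure_sup; case: ubC.
have Sb := CS _ Cb.
have cb : c < b.
  have /leb : C (c + e / 2) by apply: ceC; rewrite ltr_norml; lra.
  lra.
have NGb : ~ gap_after S b.
  move=> /(HS _ Sb)/(_ (b - c)); rewrite subr_gt0 => /(_ cb)[t /andP[ct tb]].
  by case; apply/CS/(component_itv Cc Cb); lra.
(* No gap starts at b, so S has points just after b. *)
have meet_after g : 0 < g -> exists2 t, S t & b < t < b + g.
  move=> g0; apply: contrapT => N; apply: NGb; exists g => // t bt tg St.
  by apply: N; exists t => //; rewrite bt.
move=> U /nbhs_ballP[d /= d0 dU].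
have [s Ss /andP[bs sd]] := meet_after _ d0.
have [z /andP[bz zs] NSz] : exists2 z, b <= z <= s & ~ S z.
  apply: contrapT => N; suff /leb : C s by lra.
  apply: (component_segment Cb (ltW bs)) => t bts.
  by apply: contrapT => NSt; apply: N; exists t.
have {}bz : b < z by rewrite lt_neqAle bz andbT; apply: contra_notN NSz => /eqP<-.
have [t St /andP[bt tz]] := meet_after (z - b) ltac:(lra).
(* The gap around z starts at the last point u of S before z. *)
pose T := S `&` `[b, z]; pose u := sup T.
have ubT : ubound T z by move=> v [_] /=; rewrite in_itv/= => /andP[].
have Tt : T t by split=> //=; rewrite in_itv/=; lra.
have [Su] : T u.
  rewrite (closure_id T).1; first by apply: closure_sup; [exists t|exists z].
  by apply: closedI => //; exact: itv_closed.
rewrite /= in_itv/= => /andP[bu uz].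
have tu : t <= u by apply: ub_le_sup => //; exists z.
have {}uz : u < z.
  by rewrite lt_neqAle uz andbT; apply: contra_notN NSz => /eqP<-.
exists u; split; first by rewrite gt_eqF//; exact: lt_le_trans tu.
  apply: gap_one_point => //; exists (z - u); first by rewrite subr_gt0.
  move=> v uv vz Sv; suff : v <= u by rewrite leNgt uv.
  apply: ub_le_sup; first by exists z.
  by split=> //=; rewrite in_itv/=; lra.
by apply: dU; rewrite /ball/= ltr_norml; lra.
Qed.

Lemma component_opp (R : realType) (S : set R) (x y : R) :
  connected_component S x y ->
  connected_component (-%R @` S) (- x) (- y).
Proof.
move=> [A [Ax AS cA] Ay]; exists (-%R @` A); last by exists y.
split; [by exists x|exact: image_subset|].
apply: connected_continuous_connected => //.
by apply: continuous_subspaceT => z; exact: opp_continuous.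
Qed.

Lemma component_image_opp (R : realType) (S : set R) (x : R) :
  connected_component (-%R @` S) (- x) = -%R @` connected_component S x.
Proof.
apply/seteqP; split=> [y /component_opp|_ [y xy <-]]; last exact: component_opp.
rewrite image_comp opprK (_ : -%R \o -%R = id); last first.
  by apply/funext => z /=; rewrite opprK.
rewrite image_id => xy.
by exists (- y) => //; rewrite opprK.
Qed.

Lemma one_point_opp (R : realType) (S : set R) (x : R) :
  one_point_components (-%R @` S) x -> one_point_components S (- x).
Proof.
move=> [[y Sy <-]]; rewrite component_image_opp opprK => yE; split=> //.
apply/seteqP; split=> [z yz|_ ->]; last exact: connected_component_refl.
have : [set - y] (- z) by rewrite -yE; exists z.
by move/oppr_inj.
Qed.

Lemma inf_component_limit (R : realType) (S : set R) (x : R) :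
  compact S -> gaps_before_gaps (-%R @` S) -> S x ->
  let C := connected_component S x in
  interior C !=set0 -> limit_point (one_point_components S) (inf C).
Proof.
move=> cS HS Sx C [c /interior_distP[e e0 ceC]].
have cNS : compact (-%R @` S).
  apply: continuous_compact => //.
  by apply: continuous_subspaceT => z; exact: opp_continuous.
move=> U /nbhs_ballP[d /= d0 dU].
have CNE : -%R @` C = connected_component (-%R @` S) (- x).
  by rewrite component_image_opp.
have LN : limit_point (one_point_components (-%R @` S)) (sup (-%R @` C)).
  rewrite CNE; apply: sup_component_limit => //.
  rewrite -CNE; exists (- c); apply/interior_distP; exists e => // y cy.
  exists (- y); last exact: opprK.
  by apply: ceC; rewrite -normrN opprD opprK.
have [y [yC /one_point_opp yS dy]] := LN _ (nbhsx_ballx _ _ d0).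
exists (- y); split=> //.
  by apply: contra_neq yC => yC; rewrite -[LHS]opprK yC /inf opprK.
by apply: dU; rewrite /ball/= /inf -normrN opprD !opprK.
Qed.

(** * Self-similar sets of reals *)

Lemma uniform_radius (R : realType) (T : eqType) (s : seq T)
    (P : T -> R -> Prop) :
  (forall t a b, a <= b -> P t b -> P t a) ->
  (forall t, t \in s -> exists2 e, 0 < e & P t e) ->
  exists2 e, 0 < e & forall t, t \in s -> P t e.
Proof.
move=> anti; elim: s => [|t s IH] Ps; first by exists 1.
have [a a0 Pa] := Ps t (mem_head t s).
have [|b b0 Pb] := IH; first by move=> r rs; apply: Ps; rewrite inE rs orbT.
exists (Num.min a b); first by rewrite lt_min a0 b0.
move=> r; rewrite inE => /predU1P[->|/Pb].
  by apply: anti Pa; rewrite ge_min lexx.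
by apply: anti; rewrite ge_min lexx orbT.
Qed.

Lemma small_power (R : realType) (q a e : R) :
  0 < q < 1 -> 0 < e -> exists N, q ^+ N * a < e.
Proof.
move=> /andP[q0 q1] e0.
have /(@cvg_geometric _ a) : `|q| < 1 by rewrite gtr0_norm.
move=> /cvgrPdist_lt /(_ _ e0)[N _ /(_ N (leqnn N))].
rewrite sub0r normrN /geometric/= => /(le_lt_trans (ler_norm _)) aN.
by exists N; rewrite mulrC.
Qed.

Definition self_similar (R : realType) (D : seq R) (q : R) (E : set R) : Prop :=
  forall x, E x <-> exists2 d, d \in D & exists2 y, E y & x = d + q * y.

(** Iterating the decomposition produces finitely many pieces of arbitrarily
small size, which is what the local study of E needs. *)
Lemma self_similar_iter (R : realType) (D : seq R) (q : R) (E : set R) N :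
  self_similar D q E -> exists F, self_similar F (q ^+ N) E.
Proof.
move=> ED; elim: N => [|N [F EF]].
  exists [:: 0] => x; split=> [Ex|[d]].
    by exists 0; rewrite ?mem_head//; exists x; rewrite // add0r mul1r.
  by rewrite inE => /eqP-> [y Ey ->]; rewrite add0r mul1r.
exists [seq d + q * t | d <- D, t <- F] => x; split=> [/ED|].
  move=> [d dD [y /EF[t tF [z Ez ->]] ->]].
  exists (d + q * t); first by apply/allpairsP; exists (d, t).
  by exists z; rewrite // exprS mulrDr mulrA addrA.
move=> [_ /allpairsP[[d t] /= [dD tF ->]] [z Ez ->]]; apply/ED.
exists d => //; exists (t + q ^+ N * z); last by rewrite exprS mulrDr mulrA addrA.
by apply/EF; exists t => //; exists z.
Qed.

(** Zoom in until the pieces t + p E, with p = q ^+ N, are shorter than the gap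
after u.  A piece containing a point at most u cannot jump over the gap, so it
ends at or before u; being finitely many, the pieces that end strictly before u
stay at some distance r from it.  Just before u only the piece ending at u is
left, and its gaps accumulate at u as those of E do at L. *)
Lemma self_similar_gaps (R : realType) (D : seq R) (q L : R) (E : set R) :
  0 < q < 1 -> self_similar D q E ->
  (forall x, E x -> 0 <= x <= L) -> E L -> left_limit_of_gaps E L ->
  gaps_before_gaps E.
Proof.
move=> q01 ED E0L EL gL u Eu [g g0 gE] e e0.
have q0 : 0 < q by case/andP: q01.
have [N] := small_power L q01 g0; have [F] := self_similar_iter N ED.
have : 0 < q ^+ N by rewrite exprn_gt0.
move: (q ^+ N) => p p0 EF pL.
have inE t y : t \in F -> E y -> E (t + p * y).
  by move=> tF Ey; apply/EF; exists t => //; exists y.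
have end_le t y : t \in F -> E y -> t + p * y <= u -> t + p * L <= u.
  move=> tF Ey ty; rewrite leNgt; apply/negP => ut.
  have /andP[y0 _] := E0L _ Ey; have py : 0 <= p * y by rewrite mulr_ge0// ltW.
  by apply: (gE _ ut) (inE _ _ tF EL); lra.
have [t tF [y Ey uE]] := (EF u).1 Eu.
have {}uE : u = t + p * L.
  apply/eqP; rewrite eq_le (end_le _ _ tF Ey) ?uE// andbT lerD2l.
  by rewrite ler_pM2l//; case/andP: (E0L _ Ey).
have [r r0 Fr] : exists2 r, 0 < r &
    forall s, s \in F -> s + p * L < u -> s + p * L <= u - r.
  apply: uniform_radius => [s a b ab H /H|s _]; first by move=> /le_trans->//; lra.
  have [su|us] := ltP (s + p * L) u; last by exists 1.
  by exists (u - (s + p * L)) => [|_]; lra.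
have er : 0 < Num.min e r / p by rewrite divr_gt0// lt_min e0 r0.
have [w /andP[Lw wL] Ew] := gL _ er.
have {}Lw : p * L - p * w < Num.min e r.
  by rewrite -mulrBr mulrC -ltr_pdivlMr//; lra.
have {}wL : p * w < p * L by rewrite ltr_pM2l.
have [we wr] : p * L - p * w < e /\ p * L - p * w < r.
  by move: Lw; rewrite lt_min => /andP.
exists (t + p * w); first by lra.
move=> /EF[s sF [z Ez tsE]].
have /andP[_ zL] := E0L _ Ez; have pzL : p * z <= p * L by rewrite ler_pM2l.
have sLu : s + p * L <= u by apply: (end_le _ _ sF Ez); lra.
have {}sLu : s + p * L = u.
  apply/eqP; rewrite eq_le sLu/= leNgt; apply/negP => /(Fr _ sF); lra.
have /(mulfI (lt0r_neq0 p0)) wz : p * w = p * z by lra.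
by apply: Ew; rewrite wz.
Qed.

(** An interior point c of E yields an interior point t + p c in each piece
t + p E, and the pieces are as small as desired. *)
Lemma self_similar_closure_interior (R : realType) (D : seq R) (q L : R)
    (E : set R) :
  0 < q < 1 -> self_similar D q E ->
  (forall x, E x -> 0 <= x <= L) -> closed E -> interior E !=set0 ->
  E = closure (interior E).
Proof.
move=> q01 ED E0L cE [c Ec]; have q0 : 0 < q by case/andP: q01.
apply/seteqP; split=> [x Ex|]; last first.
  rewrite [X in _ `<=` X](closure_id E).1//.
  by apply: closure_subset; exact: interior_subset.
apply/closure_distP => e e0.
have [N] := small_power L q01 e0; have [F EF] := self_similar_iter N ED.
have : 0 < q ^+ N by rewrite exprn_gt0.
move: (q ^+ N) EF => p EF p0 pL.
have [t tF [y Ey ->]] := (EF x).1 Ex.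
have bnd z : E z -> 0 <= p * z <= p * L.
  by move=> /E0L/andP[z0 zL]; rewrite ler_pM2l// zL andbT mulr_ge0// ltW.
exists (t + p * c).
  move: Ec => /interior_distP[r r0 rE]; apply/interior_distP.
  exists (p * r) => [|z cz]; first by rewrite mulr_gt0.
  apply/EF; exists t => //; exists ((z - t) / p); last first.
    by rewrite mulrC divfK ?gt_eqF//; lra.
  apply: rE; rewrite -(ltr_pM2l p0); apply: le_lt_trans cz.
  rewrite -{1}(gtr0_norm p0) -normrM mulrBr [p * (_ / p)]mulrC divfK ?gt_eqF//.
  by rewrite opprB addrCA addrA.
have := bnd _ Ey; have := bnd c (interior_subset Ec).
by rewrite ltr_norml; lra.
Qed.

(** For bounded E and 0 < q < 1, this together with self-similarity singles out
the attractor of the maps y |-> d + q y, d in D, without reference to its coding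
by digit sequences. *)
Definition maximal_self_similar (R : realType) (D : seq R) (q : R)
    (E : set R) : Prop :=
  forall (A : set R) M, (forall a, A a -> `|a| <= M) ->
    (forall a, A a -> exists2 d, d \in D & exists2 b, A b & a = d + q * b) ->
    A `<=` E.

(** The closure of E still satisfies the covering condition, because the finite
union of the closed sets d + q (closure E) is closed; maximality then puts the
closure inside E. *)
Lemma maximal_self_similar_closed (R : realType) (D : seq R) (q M : R)
    (E : set R) :
  0 < q -> self_similar D q E -> maximal_self_similar D q E ->
  (forall x, E x -> `|x| <= M) -> closed E.
Proof.
move=> q0 ED maxE EM; rewrite /closed; apply: (maxE _ (M + 1)).
  move=> a /closure_distP/(_ 1 ltr01)[y /EM yM ay].
  by rewrite -(subrK y a) (le_trans (ler_normD _ _))// addrC lerD// ltW.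
move=> a aE; apply: contrapT => N.
have [|d dD|e e0 De] := @uniform_radius _ _ D
    (fun d e => forall y, E y -> e <= `|a - (d + q * y)|).
- by move=> d b c bc H y /H; exact: le_trans.
- apply: contrapT => Nd; apply: N; exists d => //.
  exists ((a - d) / q); last by rewrite mulrC divfK ?gt_eqF//; lra.
  apply/closure_distP => e e0; apply: contrapT => Ne; apply: Nd.
  exists (q * e); first by rewrite mulr_gt0.
  move=> y Ey; rewrite leNgt; apply/negP => ye; apply: Ne; exists y => //.
  rewrite -(ltr_pM2l q0); apply: le_lt_trans ye.
  rewrite -{1}(gtr0_norm q0) -normrM mulrBr [q * (_ / q)]mulrC divfK ?gt_eqF//.
  by rewrite opprD addrA.
have [y /ED[d dD [z Ez ->]] ay] := (closure_distP _ _).1 aE _ e0.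
by move: ay; rewrite ltNge De.
Qed.

(** The point w, half-way between q L and c, is not in E: a digit at least c
overshoots it, and with digit 0 one stays in [0, q L].  Below c only the digit 0
is possible, so dividing by q shows that no q ^+ N * w is in E either. *)
Lemma self_similar_gaps_after0 (R : realType) (D : seq R) (q L c : R)
    (E : set R) :
  0 < q < 1 -> self_similar D q E -> (forall x, E x -> 0 <= x <= L) ->
  (forall d, d \in D -> d = 0 \/ c <= d) -> 0 <= L -> q * L < c ->
  forall e, 0 < e -> exists2 t, 0 < t < e & ~ E t.
Proof.
move=> q01 ED E0L Dc L0 qLc e e0; have /andP[q0 q1] := q01.
pose w := (q * L + c) / 2; have qL0 : 0 <= q * L by rewrite mulr_ge0// ltW.
have w0 : 0 < w by rewrite /w; lra.
have small_digit t : t < c -> E t -> exists2 y, E y & t = q * y.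
  move=> tc /ED[d /Dc[->|cd] [y Ey tE]]; first by exists y; rewrite // tE add0r.
  have /andP[y0 _] := E0L _ Ey; have := mulr_ge0 (ltW q0) y0; lra.
have gapN N : ~ E (q ^+ N * w).
  elim: N => [|N IH].
    rewrite mul1r => /small_digit[|y /E0L/andP[_ yL]]; first by rewrite /w; lra.
    have : q * y <= q * L by rewrite ler_pM2l.
    by rewrite /w; lra.
  move=> /small_digit[|y Ey].
    have : q ^+ N.+1 * w <= 1 * w by rewrite ler_pM2r// exprn_ile1 ?ltW.
    by rewrite /w; lra.
  by rewrite exprS -mulrA => /(mulfI (lt0r_neq0 q0)) yE; apply: IH; rewrite yE.
have [N Ne] := small_power w q01 e0.
by exists (q ^+ N * w) => //; rewrite Ne mulr_gt0// exprn_gt0.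
Qed.

(** By the symmetry s |-> L - s of E, what holds at 0 holds at L, and what
holds at right ends of components holds at left ends. *)
Lemma self_similar_cantorval (R : realType) (D : seq R) (q L c : R)
    (E : set R) :
  0 < q < 1 -> self_similar D q E -> maximal_self_similar D q E ->
  (forall x, E x -> 0 <= x <= L) -> E L -> (forall x, E x -> E (L - x)) ->
  (forall d, d \in D -> d = 0 \/ c <= d) -> q * L < c ->
  interior E !=set0 -> cantorval E.
Proof.
move=> q01 ED maxE E0L EL Esym Dc qLc iE.
have L0 : 0 <= L by case/andP: (E0L _ EL).
have clE : closed E.
  apply: (@maximal_self_similar_closed _ D q L) => //; first by case/andP: q01.
  by move=> x /E0L/andP[x0 xL]; rewrite ger0_norm.
have cE : compact E.
  apply: (subclosed_compact clE (@segment_compact _ 0 L)) => x /E0L.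
  by rewrite /= in_itv.
have gE : gaps_before_gaps E.
  apply: (self_similar_gaps q01 ED E0L EL) => e e0.
  have [t /andP[t0 te] Et] := self_similar_gaps_after0 q01 ED E0L Dc L0 qLc e0.
  by exists (L - t) => [|/Esym]; [lra|rewrite subKr].
have gNE : gaps_before_gaps (-%R @` E).
  move=> _ [v Ev <-] [g g0 gNE] e e0.
  have [|t /andP[et tv] Et] := gE _ (Esym _ Ev) _ e e0.
    exists g => // t vt tg /Esym Et.
    by apply: (gNE (t - L)); [lra|lra|exists (L - t); rewrite // opprB].
  exists (t - L) => [|[s /Esym Es sE]]; first by lra.
  by apply: Et; rewrite (_ : t = L - s)//; lra.
split => //; first by exists L.
- exact: (self_similar_closure_interior q01 ED E0L).
- move=> x Ex C iC.
  by split; [exact: inf_component_limit|exact: sup_component_limit].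
Qed.

Lemma translates_cover (R : realType) (c : R) (p : nat) (s : R) :
  1 <= c -> 0 <= s <= p%:R + c ->
  exists2 j, (j <= p)%N & 0 <= s - j%:R <= c.
Proof.
move=> c1; elim: p => [|p IH] /andP[s0 sp].
  by exists 0; rewrite // subr0 s0 -[c]add0r.
have [sp'|ps] := leP s (p%:R + c).
  by have [|j jp js] := IH; [rewrite s0|exists j; rewrite // leqW].
by exists p.+1; rewrite // -natr1 in sp *; lra.
Qed.

Lemma maximal_self_similar_interior (R : realType) (D : seq R) (q : R)
    (E : set R) (n0 n : nat) :
  0 < q < 1 -> maximal_self_similar D q E -> (0 < n)%N ->
  (forall j, (j <= n)%N -> (n0 + j)%:R \in D) -> 1 <= q * n.+1%:R ->
  interior E !=set0.
Proof.
move=> /andP[q0 q1] maxE n_gt0 nD qn.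
have n1 : 0 < n%:R :> R by rewrite ltr0n.
have r0 : 0 < 1 - q by lra.
pose a : R := n0%:R / (1 - q); pose l : R := n%:R / (1 - q).
have aE : a * (1 - q) = n0%:R by rewrite divfK ?gt_eqF.
have lE : l * (1 - q) = n%:R by rewrite divfK ?gt_eqF.
have a0 : 0 <= a by rewrite divr_ge0// ltW.
have l0 : 0 < l by rewrite divr_gt0.
have qla : 1 <= q * l.
  by rewrite -(ler_pM2r r0) -(mulrA q) lE; move: qn; rewrite -natr1; lra.
have sub : [set x | a <= x <= a + l] `<=` E.
  apply: (maxE _ (a + l)) => x /= /andP[ax xl].
    by rewrite ger0_norm//; lra.
  have [||j jn /andP[j0 jl]] := @translates_cover _ (q * l) n (x - a) => //.
    by rewrite -lE; lra.
  exists (n0 + j)%:R; first exact: nD.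
  exists ((x - (n0 + j)%:R) / q); last by rewrite mulrC divfK ?gt_eqF//; lra.
  rewrite ler_pdivlMr// ler_pdivrMr// natrD -aE; lra.
exists (a + l / 2); apply/interior_distP; exists (l / 2) => [|y]; first by lra.
by rewrite ltr_norml => yl; apply: sub => /=; lra.
Qed.

(** The alternative on the right of x holds for an interval and is stable under
union; it is the obstruction used against infinitely many gaps. *)
Lemma finite_union_germ (R : realType) (A : set R) (x : R) :
  finite_union_of_intervals A ->
  exists2 e, 0 < e & (forall t, x < t < x + e -> A t) \/
                     (forall t, x < t < x + e -> ~ A t).
Proof.
case=> s ->; elim: s => [|I s [b b0 Hs]].
  by rewrite big_nil; exists 1 => //; right=> t _ [].
rewrite big_cons.
have [a a0 HI] : exists2 e, 0 < e &
    (forall t, x < t < x + e -> [set` I] t) \/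
    (forall t, x < t < x + e -> ~ [set` I] t).
  have [N|] := pselect (forall e, 0 < e ->
      exists2 t, x < t < x + e & [set` I] t).
    have [r /andP[xr _] Ir] := N 1 ltr01.
    exists (r - x); first by rewrite subr_gt0.
    left=> t /andP[xt tr]; have [|v /andP[_ vt] Iv] := N (t - x).
      by rewrite subr_gt0.
    by apply: (interval_is_interval Iv Ir); lra.
  move=> /existsNP[e /not_implyP[e0 Ne]]; exists e => //; right=> t xt It.
  by apply: Ne; exists t.
exists (Num.min a b); first by rewrite lt_min a0 b0.
have ltmin t : x < t < x + Num.min a b -> x < t < x + a /\ x < t < x + b.
  by rewrite -!ltrBlDl lt_min => /and3P[-> -> ->].
case: HI => [HI|HI]; first by left=> t /ltmin[/HI]; left.
case: Hs => [Hs|Hs]; first by left=> t /ltmin[_ /Hs]; right.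
by right=> t /ltmin[/HI ? /Hs ?] [].
Qed.

(** Both the gaps of E and its points q ^+ N * L accumulate at 0. *)
Lemma self_similar_not_finite_union (R : realType) (D : seq R) (q L c : R)
    (E : set R) :
  0 < q < 1 -> self_similar D q E -> (forall x, E x -> 0 <= x <= L) ->
  E L -> 0 < L -> 0 \in D -> (forall d, d \in D -> d = 0 \/ c <= d) ->
  q * L < c -> ~ finite_union_of_intervals E.
Proof.
move=> q01 ED E0L EL L0 D0 Dc qLc /(@finite_union_germ _ _ 0)[e e0 []] H.
  have [t t0e] := self_similar_gaps_after0 q01 ED E0L Dc (ltW L0) qLc e0.
  by apply; apply: H; rewrite add0r.
have [N Ne] := small_power L q01 e0; have q0 : 0 < q by case/andP: q01.
apply: (H (q ^+ N * L)); first by rewrite add0r Ne mulr_gt0// exprn_gt0.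
elim: N {Ne} => [|N IH]; first by rewrite mul1r.
apply/ED; exists 0 => //; exists (q ^+ N * L) => //.
by rewrite add0r mulrA -exprS.
Qed.

(** * Multigeometric sequences *)

Section Multigeometric.
Context (R : realType) (q : R) (q01 : 0 < q < 1).
Context (m : nat) (m_gt0 : (0 < m)%N) (k : m.-tuple nat).

Local Notation x := (multigeometric k q).
Local Notation E := (achievement_set x).
Local Notation subseries eps := (series (fun i => (eps i)%:R * x i)).
Local Notation K := (\sum_(i < m) tnth k i)%N.
Local Notation L := (K%:R / (1 - q)).

Definition subset_sum (f : 'I_m -> bool) : nat := \sum_(i < m) f i * tnth k i.

Definition subset_sums : seq R :=
  [seq (subset_sum f)%:R | f : {ffun 'I_m -> bool}].

Lemma mem_subset_sums (f : 'I_m -> bool) : (subset_sum f)%:R \in subset_sums.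
Proof.
apply/mapP; exists (finfun f); rewrite ?mem_enum//; congr _%:R.
by apply: eq_bigr => i _; rewrite ffunE.
Qed.

Lemma subset_sumsP (d : R) :
  d \in subset_sums -> exists f, d = (subset_sum f)%:R.
Proof. by move=> /mapP[f _ ->]; exists f. Qed.

Lemma multigeometric_first (i : 'I_m) : x i = (tnth k i)%:R.
Proof.
rewrite /multigeometric size_tuple modn_small// divn_small// mulr1.
by rewrite (tnth_nth 0%N).
Qed.

Lemma multigeometric_next n : x (n + m)%N = q * x n.
Proof.
rewrite /multigeometric size_tuple modnDr divnDr// divnn m_gt0 addn1.
by rewrite exprS mulrCA.
Qed.

Lemma multigeometric_ge0 n : 0 <= x n.
Proof. by rewrite mulr_ge0// exprn_ge0// ltW//; case/andP: q01. Qed.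

Lemma subseries_next (eps : nat -> bool) n :
  subseries eps (n + m)%N =
  (subset_sum (fun i => eps i))%:R + q * subseries (fun i => eps (i + m)%N) n.
Proof.
rewrite /series/= !big_mkord addnC big_split_ord/= natr_sum mulr_sumr.
congr (_ + _); apply: eq_bigr => i _; last first.
  by rewrite addnC multigeometric_next mulrCA.
by rewrite multigeometric_first natrM.
Qed.

Lemma cvg_subseries_next (eps : nat -> bool) (s : R) :
  subseries (fun i => eps (i + m)%N) @ \oo --> s ->
  subseries eps @ \oo --> (subset_sum (fun i => eps i))%:R + q * s.
Proof.
move=> es; rewrite -(cvg_shiftn m).
rewrite (_ : (fun n => _) = fun n => (subset_sum (fun i => eps i))%:R +
    q * subseries (fun i => eps (i + m)%N) n); last first.
  by apply/funext => n; exact: subseries_next.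
by apply: cvgD; [exact: cvg_cst|apply: cvgMr].
Qed.

Lemma achievement_self_similar : self_similar subset_sums q E.
Proof.
have q0 : q != 0 by rewrite gt_eqF//; case/andP: q01.
move=> s; split=> [[eps es]|[_ /subset_sumsP[f ->] [y [eps ey] ->]]].
  exists (subset_sum (fun i => eps i))%:R; first exact: mem_subset_sums.
  exists ((s - (subset_sum (fun i => eps i))%:R) / q).
    exists (fun i => eps (i + m)%N); move: es; rewrite -(cvg_shiftn m) => es.
    rewrite (_ : series _ = fun n => (subseries eps (n + m)%N -
      (subset_sum (fun i => eps i))%:R) / q).
      by apply: cvgMl; apply: cvgB => //; exact: cvg_cst.
    by apply/funext => n; rewrite subseries_next addrAC subrr add0r mulrC mulKf.
  by rewrite mulrC divfK// subrKC.
pose eps' i :=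
  if (i < m)%N then f (Ordinal (ltn_pmod i m_gt0)) else eps (i - m)%N.
exists eps'; rewrite (_ : subset_sum f = subset_sum (fun i => eps' i)).
  apply: cvg_subseries_next; rewrite (_ : series _ = subseries eps)//.
  by congr series; apply/funext => i; rewrite /eps' ltnNge leq_addl addnK.
apply: eq_bigr => i _; rewrite /eps' ltn_ord; congr (f _ * _)%N.
by apply: val_inj; rewrite /= modn_small.
Qed.

(** When f chooses the first digit of a point and g the remainder, this is the
digit sequence of a: the block of m terms number j is read off the j-th iterate
of g at a. *)
Definition itinerary (f : R -> 'I_m -> bool) (g : R -> R) (a : R) (n : nat) :
  bool := f (iter (n %/ m) g a) (Ordinal (ltn_pmod n m_gt0)).

Lemma itinerary_first f g a (i : 'I_m) : itinerary f g a i = f a i.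
Proof.
rewrite /itinerary divn_small//=; congr (f _ _).
by apply: val_inj; rewrite /= modn_small.
Qed.

Lemma itinerary_next f g a n :
  itinerary f g a (n + m)%N = itinerary f g (g a) n.
Proof.
rewrite /itinerary divnDr// divnn m_gt0 addn1 iterSr; congr (f _ _).
by apply: val_inj; rewrite /= modnDr.
Qed.

(** After N full blocks the error is q ^+ N times the error made at the N-th
iterate of g before its first block is complete; the latter is bounded by M plus
the sum of one block. *)
Lemma cvg_itinerary (A : set R) (M : R) f g :
  (forall a, A a -> `|a| <= M) ->
  (forall a, A a -> A (g a) /\ a = (subset_sum (f a))%:R + q * g a) ->
  forall a, A a -> subseries (itinerary f g a) @ \oo --> a.
Proof.
move=> AM Ag; have /andP[q0 q1] := q01.
have bnd N : forall a n, A a -> (n %/ m)%N = N ->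
    `|a - subseries (itinerary f g a) n| <= q ^+ N * (M + series x m).
  elim: N => [|N IH] a n Aa nN.
    have nm : (n < m)%N.
      by rewrite ltnNge -divn_gt0// nN.
    rewrite mul1r (le_trans (ler_normB _ _))// lerD ?AM//.
    rewrite ger0_norm; last first.
      by apply: sumr_ge0 => i _; rewrite mulr_ge0// multigeometric_ge0.
    rewrite /series/= [leRHS](big_cat_nat (n := n))//=; last exact: ltnW.
    rewrite -[leLHS]addr0; apply: lerD.
      apply: ler_sum => i _; rewrite ler_piMl ?multigeometric_ge0//.
      by case: (itinerary _ _ _ _).
    by apply: sumr_ge0 => i _; exact: multigeometric_ge0.
  have mn : (m <= n)%N by rewrite -divn_gt0// nN.
  have [Aga aE] := Ag _ Aa.
  have /(IH _ (n - m)%N Aga) : ((n - m) %/ m)%N = N.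
    by move: nN; rewrite -{1}(subnK mn) divnDr// divnn m_gt0 addn1 => -[].
  rewrite -(ler_pM2l q0) mulrA -exprS; apply: le_trans.
  rewrite -{2}(gtr0_norm q0) -normrM -{1}(subnK mn) subseries_next.
  rewrite (_ : subset_sum _ = subset_sum (f a)); last first.
    by apply: eq_bigr => i _; rewrite itinerary_first.
  under [X in series X]eq_fun do rewrite itinerary_next.
  by rewrite {1}aE opprD addrACA subrr add0r mulrBr.
move=> a Aa; apply/cvgrPdist_lt => e e0.
have [N Ne] := small_power (M + series x m) q01 e0.
exists (N * m)%N => // n /= Nn; apply: le_lt_trans (bnd _ _ _ Aa erefl) _.
apply: le_lt_trans Ne; rewrite ler_wpM2r//.
  rewrite addr_ge0//; first exact: le_trans (AM _ Aa).
  by apply: sumr_ge0 => i _; exact: multigeometric_ge0.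
by rewrite ler_wiXn2l ?ltW// leq_divRL.
Qed.

Lemma achievement_maximal : maximal_self_similar subset_sums q E.
Proof.
move=> A M AM AD.
have /choice[p pP] a : exists p : ('I_m -> bool) * R,
    A a -> A p.2 /\ a = (subset_sum p.1)%:R + q * p.2.
  have [/AD[_ /subset_sumsP[f ->] [b Ab ab]]|nAa] := pselect (A a).
    by exists (f, b).
  by exists (xpredT, a).
move=> a Aa; exists (itinerary (fun a => (p a).1) (fun a => (p a).2) a).
exact: (cvg_itinerary AM pP).
Qed.

(** L is the point with constant itinerary that always takes all of k, since
L = K + q L. *)
Lemma cvg_multigeometric : series x @ \oo --> L.
Proof.
have /andP[q0 q1] := q01.
have LE : L = (subset_sum xpredT)%:R + q * L.
  rewrite (_ : subset_sum _ = K); last by apply: eq_bigr => i _; rewrite mul1n.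
  have : L * (1 - q) = K%:R by rewrite divfK// subr_eq0 gt_eqF.
  by lra.
have := @cvg_itinerary [set L] `|L| (fun=> xpredT) (fun=> L).
move=> /(_ _ _ L erefl); rewrite (_ : (fun i => _ * x i) = x); last first.
  by apply/funext => i; rewrite mul1r.
by apply; [move=> _ ->|move=> _ ->].
Qed.

Lemma achievement_total : E L.
Proof.
exists xpredT; rewrite (_ : (fun i => _ * x i) = x); last first.
  by apply/funext => i; rewrite mul1r.
exact: cvg_multigeometric.
Qed.

Lemma achievement_sym s : E s -> E (L - s).
Proof.
move=> [eps es]; exists (fun i => ~~ eps i).
rewrite (_ : series _ = fun n => series x n - subseries eps n).
  by apply: cvgB => //; exact: cvg_multigeometric.
apply/funext => n; rewrite /series/= -sumrB; apply: eq_bigr => i _.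
by case: (eps i); rewrite ?mul1r ?mul0r ?subrr ?subr0.
Qed.

Lemma achievement_bounds s : E s -> 0 <= s <= L.
Proof.
have E_ge0 t : E t -> 0 <= t.
  move=> [eps et]; rewrite -(cvg_lim (@Rhausdorff R) et).
  apply: limr_ge; first by apply/cvg_ex; exists t.
  apply: nearW => n; apply: sumr_ge0 => i _.
  by rewrite mulr_ge0// multigeometric_ge0.
by move=> Es; rewrite E_ge0//= -subr_ge0 E_ge0//; exact: achievement_sym.
Qed.

End Multigeometric.

Theorem theorem2 (R : realType) (q : R) (hq0 : 0 < q) (hq1 : q < 1 / 2)
  (m : nat) (hm : (0 < m)%N) (k : m.-tuple nat)
  (hkpos : forall i : 'I_m, (0 < tnth k i)%N)
  (hkdec : forall i j : 'I_m, (i <= j)%N -> (tnth k j <= tnth k i)%N)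
  (n0 n : nat) (hn0 : (0 < n0)%N) (hn : (0 < n)%N)
  (hsub : forall j : nat, (j <= n)%N ->
     exists eps : 'I_m -> bool, (n0 + j = \sum_(i < m) eps i * tnth k i)%N) :
  let K := (\sum_(i < m) tnth k i)%N in
  let km := last 0%N k in
  let E := achievement_set (multigeometric k q) in
  [/\ 1 / n.+1%:R <= q -> interior E !=set0,
      q < km%:R / (K + km)%:R -> ~ finite_union_of_intervals E &
      1 / n.+1%:R <= q -> q < km%:R / (K + km)%:R -> cantorval E].
Proof.
move=> K km E.
have q01 : 0 < q < 1 by rewrite hq0/=; lra.
have ED : self_similar (subset_sums R k) q E by exact: achievement_self_similar.
have maxE : maximal_self_similar (subset_sums R k) q E.
  exact: achievement_maximal.
pose L : R := K%:R / (1 - q).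
have E0L s : E s -> 0 <= s <= L by exact: achievement_bounds.
have EL : E L by exact: achievement_total.
have kmE : km = tnth k (Ordinal (etrans (ltn_predL m) hm)).
  by rewrite (tnth_nth 0%N) /km -nth_last size_tuple.
have km_gt0 : (0 < km)%N by rewrite kmE.
have K_gt0 : (0 < K)%N.
  by rewrite lt0n sum_nat_eq0; apply/forallPn; exists (Ordinal hm); rewrite -lt0n.
have L0 : 0 < L by rewrite divr_gt0 ?ltr0n//; lra.
have Dkm d : d \in subset_sums R k -> d = 0 \/ km%:R <= d.
  move=> /subset_sumsP[f ->].
  have [f0|/forallPn[i]] := boolP [forall i, ~~ f i].
    left; rewrite /subset_sum big1// => i _.
    by rewrite (negbTE (forallP f0 i)).
  rewrite negbK => fi; right; rewrite ler_nat /subset_sum (bigD1 i)//= fi mul1n.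
  by apply: leq_trans (leq_addr _ _); rewrite kmE hkdec//= -ltnS prednK.
have tail_lt : q < km%:R / (K + km)%:R -> q * L < km%:R.
  rewrite ltr_pdivlMr ?ltr0n ?addn_gt0 ?K_gt0// mulrA ltr_pdivrMr ?natrD; lra.
have intE : 1 / n.+1%:R <= q -> interior E !=set0.
  rewrite ler_pdivrMr ?ltr0n// => qn.
  apply: (maximal_self_similar_interior (n0 := n0) q01 maxE hn) => // j /hsub[f ->].
  exact: mem_subset_sums.
split=> //.
- move=> /tail_lt qL; apply: (self_similar_not_finite_union q01 ED E0L) Dkm qL => //.
  rewrite (_ : 0 = (subset_sum k xpred0)%:R); first exact: mem_subset_sums.
  by rewrite /subset_sum big1.
- move=> /intE iE /tail_lt qL.
  apply: (self_similar_cantorval q01 ED maxE E0L EL) Dkm qL iE.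
  exact: achievement_sym.
Qed.
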